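(* For all integers $n,k\ge 0$, the polynomial $$A_{n,k}(q)=\sum_{\substack{\sigma\in \mathrm{Av}_n(321)\\ \mathrm{des}\,\sigma=k}} q^{\mathrm{maj}\,\sigma}$$ is symmetric.
   Context: Let $\mathfrak S_n$ be the symmetric group of permutations $\sigma=b_1\ldots b_n$ (in one-line notation) of $[n]=\{1,\ldots,n\}$; $\mathfrak S_0$ consists of the empty permutation. Let $\mathrm{Av}_n(321)$ be the set of $\sigma=b_1\ldots b_n\in\mathfrak S_n$ avoiding the pattern $321$, i.e. such that there are no indices $i<j<l$ with $b_i>b_j>b_l$. For $\sigma=b_1\ldots b_n$ let $\mathrm{Des}\,\sigma=\{i \mid 1\le i\le n-1,\ b_i>b_{i+1}\}$, $\mathrm{des}\,\sigma=\#\mathrm{Des}\,\sigma$ (number of descents), and $\mathrm{maj}\,\sigma=\sum_{i\in\mathrm{Des}\,\sigma} i$ (major index). Equivalently, $A_{n,k}(q)$ is the coefficient of $t^k$ in $M_n(q,t)=\sum_{\sigma\in\mathrm{Av}_n(321)}q^{\mathrm{maj}\,\sigma}t^{\mathrm{des}\,\sigma}$. A polynomial $f(x)=\sum_{i=r}^s a_i x^i$ with $a_r,a_s\neq 0$ is called symmetric if $a_i=a_j$ whenever $i+j=r+s$. The zero polynomial (which occurs when no $\sigma\in\mathrm{Av}_n(321)$ has $k$ descents) is regarded as symmetric. *)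

(* Defs.v *)
From mathcomp Require Import all_boot all_order all_algebra all_fingroup.

Set Implicit Arguments.
Unset Strict Implicit.
Unset Printing Implicit Defensive.

Import GRing.Theory.
Local Open Scope ring_scope.

(* A permutation b_1 ... b_n of {1, ..., n} is encoded as s : 'S_n acting on
   {0, ..., n-1}, with b_i = s (i - 1) + 1. *)

Definition Av321 (n : nat) : {set 'S_n} :=
  [set s : 'S_n | ~~ [exists i : 'I_n, exists j : 'I_n, exists l : 'I_n,
     [&& (i < j)%N, (j < l)%N, (s j < s i)%N & (s l < s j)%N]]].

(* The elements of Des s are the 1-based positions i of the descents: since
   i : 'I_n, the condition p.+1 = i forces 1 <= i <= n - 1, and then
   b_i = s p + 1 and b_(i+1) = s i + 1. *)
Definition Des (n : nat) (s : 'S_n) : {set 'I_n} :=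
  [set i : 'I_n | [exists p : 'I_n, (p.+1 == i :> nat) && (s i < s p)%N]].

Definition des (n : nat) (s : 'S_n) : nat := #|Des s|.

Definition maj (n : nat) (s : 'S_n) : nat := (\sum_(i in Des s) i)%N.

Definition A_poly (n k : nat) : {poly int} :=
  \sum_(s in Av321 n | des s == k) 'X^(maj s).

Definition symmetric_poly (R : nzRingType) (f : {poly R}) : Prop :=
  f = 0 \/
  exists r s : nat,
    [/\ (r <= s)%N,
        f = \sum_(r <= i < s.+1) f`_i *: 'X^i,
        f`_r != 0,
        f`_s != 0 &
        forall i j : nat, (r <= i <= s)%N -> (r <= j <= s)%N ->
          (i + j = r + s)%N -> f`_i = f`_j].

(* Main.v *)
Require Import Defs.
From mathcomp Require Import all_boot all_order all_algebra all_fingroup.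
From mathcomp Require Import zify.

(** The reverse-complement b_i |-> n + 1 - b_(n+1-i) is an involution of
    Av_n(321) that maps the descent set D to n - D.  Hence it preserves des and
    turns maj into n * des - maj, so A_(n,k) is palindromic about n * k / 2. *)

Set Implicit Arguments.
Unset Strict Implicit.
Unset Printing Implicit Defensive.

Import GRing.Theory.
Local Open Scope ring_scope.

(** The reflection i -> N - i exchanges top and bottom coefficients, so a nonzero [f] of degree d
    has lowest exponent N - d, and r + s = N. *)
Lemma symmetric_poly_palindromic (R : nzRingType) (f : {poly R}) (N : nat) :
  (size f <= N.+1)%N ->
  (forall i j : nat, (i + j = N)%N -> f`_i = f`_j) ->
  symmetric_poly f.
Proof.
move=> size_f f_sym; have [->|f_neq0] := eqVneq f 0; first by left.
have [d size_fE] : {d | size f = d.+1}.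
  by exists (size f).-1; rewrite prednK // size_poly_gt0.
have lead_neq0 : f`_d != 0 by rewrite -[d]/d.+1.-1 -size_fE lead_coef_eq0.
rewrite size_fE ltnS in size_f.
have low0 i : (i < N - d)%N -> f`_i = 0.
  move=> lt_i; rewrite (f_sym i (N - i)%N); last by lia.
  by have /leq_sizeP -> // : (size f <= d.+1)%N; [rewrite size_fE | lia].
right; exists (N - d)%N, d.
(* If d < N - d, then [low0] would kill the leading coefficient. *)
have le_rs : (N - d <= d)%N by rewrite leqNgt; apply: contra_neqN lead_neq0 => /low0.
split=> //.
- rewrite -[LHS]coefK size_fE poly_def -(big_mkord xpredT (fun i => f`_i *: 'X^i)).
  rewrite (@big_cat_nat _ _ _ (N - d)) //=; last by lia.
  rewrite big_nat big1 ?add0r // => i /andP[_ /low0 ->].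
  by rewrite scale0r.
- by rewrite (f_sym (N - d)%N d) // subnK.
- by move=> i j _ _ ij; apply: f_sym; rewrite ij subnK.
Qed.

(** Index 0 has no predecessor, hence is never in [Des s]. Indexing by adjacent pairs removes the
    existential and turns reversal into a plain reindexing. *)
Lemma sum_Des (m : nat) (s : 'S_m.+1) (F : nat -> nat) :
  (\sum_(i in Des s) F i =
   \sum_(i < m | s (lift ord0 i) < s (widen_ord (leqnSn m) i)) F i.+1)%N.
Proof.
rewrite big_mkcond big_ord_recl /= [RHS]big_mkcond /=.
rewrite ifF ?add0n; last by rewrite inE; apply/existsP => -[p /andP[]].
apply: eq_bigr => i _; rewrite inE; congr (if _ then _ else _).
apply/existsP/idP => [[p /andP[/eqP[pi] lt_s]] | lt_s].
  by rewrite (_ : widen_ord _ i = p) //; apply: val_inj => /=.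
by exists (widen_ord (leqnSn m) i); rewrite lt_s andbT.
Qed.

Definition rev_compl_fun (n : nat) (s : 'S_n) (i : 'I_n) : 'I_n :=
  rev_ord (s (rev_ord i)).

Lemma rev_compl_inj (n : nat) (s : 'S_n) : injective (rev_compl_fun s).
Proof. by move=> i j /rev_ord_inj/perm_inj/rev_ord_inj. Qed.

Definition rev_compl (n : nat) (s : 'S_n) : 'S_n := perm (@rev_compl_inj n s).

Lemma rev_complE (n : nat) (s : 'S_n) (i : 'I_n) :
  rev_compl s i = rev_ord (s (rev_ord i)).
Proof. by rewrite permE. Qed.

Lemma rev_complK (n : nat) : involutive (@rev_compl n).
Proof. by move=> s; apply/permP => i; rewrite !rev_complE !rev_ordK. Qed.

Lemma ltn_rev_ord (n : nat) (i j : 'I_n) : (rev_ord i < rev_ord j)%N = (j < i)%N.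
Proof. by have := ltn_ord i; have := ltn_ord j; rewrite /=; lia. Qed.

(** Reversing both positions and values carries a 321 pattern at i < j < l to one at the reflected
    positions, taken in the opposite order. *)
Lemma rev_compl_Av321 (n : nat) (s : 'S_n) :
  (rev_compl s \in Av321 n) = (s \in Av321 n).
Proof.
wlog suff imp : s / s \in Av321 n -> rev_compl s \in Av321 n.
  by apply/idP/idP => [/imp|/imp //]; rewrite rev_complK.
rewrite !inE; apply: contra => /existsP[i /existsP[j /existsP[l]]].
rewrite !rev_complE !ltn_rev_ord => /and4P[ij jl sij sjl].
apply/existsP; exists (rev_ord l); apply/existsP; exists (rev_ord j).
by apply/existsP; exists (rev_ord i); rewrite !ltn_rev_ord ij jl sij sjl.
Qed.

(** The arbitrary weight [F] serves both statistics: constant 1 gives [des], the identity gives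
    [maj]. *)
Lemma sum_Des_rev_compl (n : nat) (s : 'S_n) (F : nat -> nat) :
  (\sum_(i in Des (rev_compl s)) F i = \sum_(i in Des s) F (n - i))%N.
Proof.
case: n s => [|m] s; first by rewrite !big_mkcond !big_ord0.
rewrite sum_Des (sum_Des s (fun i => F (m.+1 - i)%N)).
(* On the m adjacent pairs, [rev_ord] sends i to m - 1 - i, so the descent position i + 1 becomes m
   - i = (m + 1) - (i + 1). *)
rewrite (reindex_inj rev_ord_inj) /=; apply: eq_big => [i | i _].
  rewrite !rev_complE ltn_rev_ord; congr (s _ < s _)%N.
    by apply: val_inj; have := ltn_ord i; rewrite /= /bump /=; lia.
  by apply: val_inj; have := ltn_ord i; rewrite /= /bump /=; lia.
by congr F; have := ltn_ord i; lia.
Qed.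

Lemma des_rev_compl (n : nat) (s : 'S_n) : des (rev_compl s) = des s.
Proof. by rewrite /des -!sum1_card (sum_Des_rev_compl s (fun=> 1%N)). Qed.

Lemma maj_rev_compl (n : nat) (s : 'S_n) :
  (maj (rev_compl s) + maj s = n * des s)%N.
Proof.
rewrite /maj (sum_Des_rev_compl s id) -big_split /= /des mulnC -sum_nat_const.
by apply: eq_bigr => i _; rewrite subnK // ltnW.
Qed.

Lemma coef_A_poly (n k i : nat) :
  (A_poly n k)`_i = \sum_(s in Av321 n | des s == k) (i == maj s)%:R.
Proof. by rewrite coef_sum; apply: eq_bigr => s _; rewrite coefXn. Qed.

Theorem theorem2p1 (n k : nat) : symmetric_poly (A_poly n k).
Proof.
apply: (@symmetric_poly_palindromic _ _ (n * k)) => [|i j ij].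
  apply/leq_sizeP => i lt_i; rewrite coef_A_poly big1 // => s /andP[_ /eqP des_s].
  (* Both major indices are nonnegative with sum n * k, so neither exceeds n * k. *)
  by have := maj_rev_compl s; rewrite des_s; case: eqP => // <-; lia.
rewrite !coef_A_poly (reindex_inj (inv_inj (@rev_complK n))) /=.
apply: eq_big => [s | s /andP[_ /eqP]]; first by rewrite rev_compl_Av321 des_rev_compl.
rewrite des_rev_compl => des_s; have := maj_rev_compl s; rewrite des_s => maj_s.
(* As i + j = n * k is also the sum of the two major indices, i equals one exactly when j equals the
   other. *)
by congr (_%:R); congr nat_of_bool; lia.
Qed.
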